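(* Let $r\ge1$, $\mathbf n=(n_1,\dots,n_r)\in\mathbb N_0^r$, $\mathbf a,\mathbf b\in\mathbb R^{r+1}$, $\mathbf x\in\mathbb C^r$, such that no lower parameter of the ${}_3F_2$'s occurring below is a nonpositive integer and no denominator below vanishes. Then $$\begin{aligned}&E_0\;{}_rS_{\mathbf n}(\mathbf x;\mathbf a,\mathbf b)+E_1\;{}_rS_{\mathbf n}(\mathbf x;a_1,\dots,a_{r-1},a_r+1,a_{r+1}-1,b_1,\dots,b_{r-1},b_r-1,b_{r+1}+1)\\&\quad+E_2\;{}_rS_{\mathbf n}(\mathbf x;a_1,\dots,a_{r-1},a_r+2,a_{r+1}-2,b_1,\dots,b_{r-1},b_r-2,b_{r+1}+2)=0,\end{aligned}$$ where $$E_0=-\frac{b_r-1+\frac{x_r}{2}}{a_{r+1}+\frac{x_r}{2}},$$ $$E_1=\frac{|\mathbf a^r|(a_{r+1}+b_{r+1})+n_r\big(n_r+|\mathbf a^r|+|\mathbf b^r|-1\big)}{\big(a_{r+1}+\frac{x_r}{2}-1\big)_2}-\frac{|\mathbf a^r|-b_r+b_{r+1}+2-x_r}{a_{r+1}+\frac{x_r}{2}},$$ $$E_2=-\frac{\big(a_r-\frac{x_r}{2}+1\big)\big(b_{r+1}-\frac{x_r}{2}+1\big)}{\big(a_{r+1}+\frac{x_r}{2}-1\big)_2}.$$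
   Context: Notation: $(c)_k=c(c+1)\cdots(c+k-1)$, $(c)_0=1$; ${}_3F_2\left(\begin{matrix}c_1,c_2,c_3\\ d_1,d_2\end{matrix}\Big|z\right)=\sum_{k\ge0}\frac{(c_1)_k(c_2)_k(c_3)_k}{(d_1)_k(d_2)_k}\frac{z^k}{k!}$ (a finite sum when $c_1=-n$, $n\in\mathbb N_0=\{0,1,\dots\}$). For $r\ge1$, $\mathbf n=(n_1,\dots,n_r)$, $\mathbf a=(a_1,\dots,a_{r+1})$, $\mathbf b=(b_1,\dots,b_{r+1})$: $|\mathbf n^j|=n_j+\cdots+n_r$ with $|\mathbf n^{r+1}|=0$, $|\mathbf a^j|=a_j+\cdots+a_{r+1}$, $|\mathbf b^j|=b_j+\cdots+b_{r+1}$. For $\mathbf x=(x_1,\dots,x_r)$, $${}_rS_{\mathbf n}(\mathbf x;\mathbf a,\mathbf b)=\prod_{j=1}^r\left\{\Big(|\mathbf a^{j+1}|+\frac{x_j}{2}\Big)_{|\mathbf n^{j+1}|}\;{}_3F_2\left(\begin{matrix}-n_j,\;n_j+2|\mathbf n^{j+1}|+|\mathbf a^j|+|\mathbf b^j|-1,\;|\mathbf n^{j+1}|+|\mathbf a^{j+1}|+\frac{x_j}{2}\\ 2|\mathbf n^{j+1}|+|\mathbf a^{j+1}|+|\mathbf b^{j+1}|,\;|\mathbf n^{j+1}|+|\mathbf a^j|\end{matrix}\,\Big|\,1\right)\right\}.$$ *)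

(* Defs.v *)
From mathcomp Require Import all_boot all_order all_algebra.
From mathcomp Require Import complex.
From mathcomp Require Import boolp classical_sets reals topology normedtype sequences.

Set Implicit Arguments.
Unset Strict Implicit.
Unset Printing Implicit Defensive.

Import Order.TTheory GRing.Theory Num.Theory.
Import numFieldTopology.Exports.

Local Open Scope ring_scope.
Local Open Scope complex_scope.

Section Defs.
Variable R : realType.
Local Notation C := R[i].

Definition poch (c : C) (k : nat) : C := \prod_(i < k) (c + i%:R).

Definition hyp3F2_term (c1 c2 c3 d1 d2 z : C) (k : nat) : C :=
  poch c1 k * poch c2 k * poch c3 k / (poch d1 k * poch d2 k) * (z ^+ k / k`!%:R).

(* [C^o] is [C] seen with the topology of its modulus. *)
Definition hyp3F2 (c1 c2 c3 d1 d2 z : C) : C :=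
  limn (series (hyp3F2_term c1 c2 c3 d1 d2 z : nat -> C^o)).

Lemma hyp3F2_terminating (n : nat) (c2 c3 d1 d2 z : C) :
  hyp3F2 (- n%:R) c2 c3 d1 d2 z =
  \sum_(k < n.+1) hyp3F2_term (- n%:R) c2 c3 d1 d2 z k.
Proof.
have term0 k : (n < k)%N -> hyp3F2_term (- n%:R) c2 c3 d1 d2 z k = 0.
  move=> nk; rewrite /hyp3F2_term /poch (bigD1 (Ordinal nk)) //= addNr.
  by rewrite !mul0r.
apply: (@lim_near_cst C^o); first exact: (@norm_hausdorff C C^o).
exists n.+1 => // m /= nm.
rewrite /series /= -(subnKC nm) big_mkord big_split_ord /=.
by rewrite [X in _ + X]big1 ?addr0// => k _; apply: term0; rewrite leq_addr.
Qed.

(* Vectors (v_1, ..., v_m) are functions on ['I_m], so that the entry v_j has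
   index j - 1; hence [tail v j] is |v^(j+1)| = v_(j+1) + ... + v_m. *)
Definition tail (V : nmodType) (m : nat) (v : 'I_m -> V) (j : nat) : V :=
  \sum_(i < m | (j <= i)%N) v i.

Section Params.
Variables (r : nat) (n : 'I_r -> nat) (a b : 'I_r.+1 -> R) (j : 'I_r).

Definition lower1 : C :=
  (2 * tail n j.+1)%N%:R + (tail a j.+1)%:C + (tail b j.+1)%:C.

Definition lower2 : C := (tail n j.+1)%:R + (tail a j)%:C.

End Params.

Definition rS (r : nat) (n : 'I_r -> nat) (x : 'I_r -> C)
    (a b : 'I_r.+1 -> R) : C :=
  \prod_(j < r)
    (poch ((tail a j.+1)%:C + x j / 2) (tail n j.+1) *
     hyp3F2 (- (n j)%:R)
            ((n j)%:R + (2 * tail n j.+1)%N%:R + (tail a j)%:C + (tail b j)%:C - 1)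
            ((tail n j.+1)%:R + (tail a j.+1)%:C + x j / 2)
            (lower1 n a b j) (lower2 n a j) 1).

Definition nonpos_integer (z : C) : Prop := exists m : nat, z = - m%:R.

Definition lower_admissible (r : nat) (n : 'I_r -> nat) (a b : 'I_r.+1 -> R) :
    Prop :=
  forall j : 'I_r,
    ~ nonpos_integer (lower1 n a b j) /\ ~ nonpos_integer (lower2 n a j).

Definition penult (r : nat) : 'I_r.+2 := inord r.

Definition shift (r : nat) (v : 'I_r.+2 -> R) (c : R) : 'I_r.+2 -> R :=
  fun i => if i == penult r then v i + c
           else if i == ord_max then v i - c
           else v i.

Section Coefficients.
Variables (r : nat) (n : 'I_r.+1 -> nat) (x : 'I_r.+1 -> C) (a b : 'I_r.+2 -> R).
Let xr : C := x ord_max.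
Let nr : C := (n ord_max)%:R.
Let a_r : C := (a (penult r))%:C.
Let a_r1 : C := (a ord_max)%:C.
Let b_r : C := (b (penult r))%:C.
Let b_r1 : C := (b ord_max)%:C.
Let Ar : C := (tail a r)%:C.
Let Br : C := (tail b r)%:C.

Definition den1 : C := a_r1 + xr / 2.

Definition den2 : C := poch (a_r1 + xr / 2 - 1) 2.

Definition E0 : C := - ((b_r - 1 + xr / 2) / den1).

Definition E1 : C :=
  (Ar * (a_r1 + b_r1) + nr * (nr + Ar + Br - 1)) / den2
  - (Ar - b_r + b_r1 + 2 - xr) / den1.

Definition E2 : C := - ((a_r - xr / 2 + 1) * (b_r1 - xr / 2 + 1) / den2).

End Coefficients.

End Defs.

(* Main.v *)
Require Import Defs.
From mathcomp Require Import all_boot all_order all_algebra.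
From mathcomp Require Import complex reals.
From mathcomp Require Import ring.

(** Only the last factor of [rS] is affected by the shifts, and there only the
    numerator parameter [c = a_(r+1) + x_r / 2] of the 3F2 moves, to [c - 1] and
    [c - 2].  The relation is therefore the second-order difference equation in
    the variable [c] of a Hahn polynomial.  With [u = c - 1], the difference
    operator maps [(u)_k] to a combination of [(u)_k] and [(u)_(k-1)], and the
    recursion of the hypergeometric coefficients makes the resulting sum
    telescope. *)

Import GRing.Theory.

Local Open Scope ring_scope.
Local Open Scope complex_scope.

Section Hahn.
Variable R : realType.
Implicit Types (c u s p q : R[i]) (k m : nat).

Lemma poch0 c : poch c 0 = 1.
Proof. exact: big_ord0. Qed.

Lemma pochSr c k : poch c k.+1 = poch c k * (c + k%:R).
Proof. exact: big_ord_recr. Qed.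

Lemma pochS c k : poch c k.+1 = c * poch (c + 1) k.
Proof.
rewrite /poch big_ord_recl addr0; congr (_ * _).
by apply: eq_bigr => i _; rewrite lift0 -natr1; ring.
Qed.

Lemma poch_neg_eq0 m : poch (- m%:R : R[i]) m.+1 = 0.
Proof. by rewrite pochSr addNr mulr0. Qed.

Lemma poch_neq0 c k : ~ nonpos_integer c -> poch c k != 0.
Proof.
move=> cN; apply/prodf_neq0 => i _; apply/eqP => ci0.
by apply: cN; exists i; apply/eqP; rewrite -addr_eq0 ci0.
Qed.

(** [hahn_down] and [hahn_up] are the coefficients of the backward and forward differences in the
    Hahn difference equation. *)
Definition hahn_down p q u : R[i] := (u - p) * (u - q).

Definition hahn_up p s u : R[i] := u * (u + s - p).

(** For positive [k] every term is a polynomial multiple of [poch u k.-1]; for [poch (u + 1) k] this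
    uses the factor [u] of [hahn_up]. At [k = 0] the factor [k%:R] kills the term with [k.-1]. *)
Lemma hahn_operator_poch p q s u k :
  hahn_down p q u * (poch (u - 1) k - poch u k)
  + hahn_up p s u * (poch (u + 1) k - poch u k)
  = k%:R * (k%:R + q + s - 1) * poch u k
    - k%:R * (k%:R - 1 + q) * (k%:R - 1 + p) * poch u k.-1.
Proof.
case: k => [|k]; first by rewrite !poch0; ring.
have upE : hahn_up p s u * poch (u + 1) k.+1
    = (u + s - p) * (poch u k * (u + k%:R)) * (u + 1 + k%:R).
  by rewrite -pochSr [poch u _]pochS pochSr /hahn_up; ring.
rewrite mulrBr [hahn_up _ _ _ * (_ - _)]mulrBr upE.
rewrite [poch (u - 1) _]pochS subrK !pochSr -natr1 /= /hahn_down /hahn_up.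
by ring.
Qed.

Lemma hahn_difference_eq m p q s u :
  ~ nonpos_integer p -> ~ nonpos_integer q ->
  let F c := hyp3F2 (- m%:R) (m%:R + q + s - 1) c p q 1 in
  hahn_down p q u * (F (u - 1) - F u) + hahn_up p s u * (F (u + 1) - F u)
  = m%:R * (m%:R + q + s - 1) * F u.
Proof.
move=> pN qN /=; rewrite !hyp3F2_terminating; apply/eqP; rewrite -subr_eq0.
rewrite -!sumrB !mulr_sumr -big_split /= -sumrB; apply/eqP.
set e := m%:R + q + s - 1.
(* [t k] is the coefficient of [poch c k] in the series, and [G k] is the lower-order term that the
   operator produces from it. *)
pose t k := poch (- m%:R) k * poch e k / (poch p k * poch q k) / k`!%:R.
pose G k := t k * (k%:R * (k%:R - 1 + q) * (k%:R - 1 + p) * poch u k.-1).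
have tS k : t k.+1 * ((k%:R + 1) * (k%:R + q) * (k%:R + p))
    = t k * ((k%:R - m%:R) * (k%:R + e)).
  have := poch_neq0 p k.+1 pN; have := poch_neq0 q k.+1 qN.
  rewrite /t !pochSr !mulf_eq0 !negb_or => /andP[q0 qk0] /andP[p0 pk0].
  have k0 : k`!%:R != 0 :> R[i] by rewrite Num.Theory.pnatr_eq0 -lt0n fact_gt0.
  have k1 : k%:R + 1 != 0 :> R[i] by rewrite natr1 Num.Theory.pnatr_eq0.
  rewrite factS natrM -natr1; field.
  by rewrite k0 k1 p0 q0 pk0 qk0.
transitivity (\sum_(0 <= k < m.+1) (G k.+1 - G k)).
  rewrite big_mkord; apply: eq_bigr => -[k _] _ /=.
  have termE c : hyp3F2_term (- m%:R) e c p q 1 k = t k * poch c k.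
    by rewrite /hyp3F2_term /t expr1n; ring.
  rewrite !termE -!mulrBr !(mulrCA _ (t k)) -!mulrDr hahn_operator_poch.
  (* Since [e = m + q + s - 1], subtracting the eigenvalue gives [k (k + q + s - 1) - m e = (k - m)
     (k + e)], the factor in [tS]. *)
  have -> : G k.+1 = t k * ((k%:R - m%:R) * (k%:R + e)) * poch u k.
    by rewrite -tS /G -natr1 /=; ring.
  by rewrite /G /e; ring.
(* [G 0] vanishes by its factor [k], and [G m.+1] because [poch (- m) m.+1 = 0]. *)
by rewrite telescope_sumr // /G /t poch_neg_eq0; ring.
Qed.

End Hahn.

Section Shift.
Variables (R : realType) (r : nat).
Implicit Types (n : 'I_r.+1 -> nat) (x : 'I_r.+1 -> R[i]) (a b v : 'I_r.+2 -> R).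

Lemma tail_last (V : nmodType) m (v : 'I_m.+1 -> V) : tail v m = v ord_max.
Proof.
rewrite /tail (bigD1 ord_max) //= big1 ?addr0 // => i /andP[mi /eqP[]].
by apply: val_inj; apply/eqP; rewrite eqn_leq mi -ltnS ltn_ord.
Qed.

Lemma tail_oversize (V : nmodType) m (v : 'I_m -> V) : tail v m = 0.
Proof. by rewrite /tail big1 // => i; rewrite leqNgt ltn_ord. Qed.

Lemma penult_neq_max : penult r != ord_max.
Proof. by rewrite -val_eqE /= inordK // ltn_eqF. Qed.

Lemma tail_penult v : tail v r = v (penult r) + v ord_max.
Proof.
rewrite /tail (bigD1 (penult r)) /=; last by rewrite inordK.
congr (_ + _); rewrite (bigD1 ord_max) /=; last first.
  by rewrite leqnSn eq_sym penult_neq_max.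
rewrite big1 ?addr0 // => i /andP[/andP[ri /eqP ip] /eqP im]; exfalso.
have := ltn_ord i; rewrite ltnS leq_eqVlt => /orP[/eqP iE|ir].
  by apply: im; apply: val_inj.
apply: ip; apply: val_inj; rewrite /= inordK //.
by apply/eqP; rewrite eqn_leq ri -ltnS ir.
Qed.

Lemma shift_max v c : shift v c ord_max = v ord_max - c.
Proof. by rewrite /shift eq_sym (negPf penult_neq_max) eqxx. Qed.

(** For [j <= r] the tail contains both modified entries, and their changes [c] and [- c] cancel. *)
Lemma tail_shift v c j : (j <= r)%N -> tail (shift v c) j = tail v j.
Proof.
move=> jr; rewrite /tail.
have jp : (j <= penult r)%N by rewrite inordK.
have jm : (j <= @ord_max r.+1)%N && (ord_max != penult r).
  by rewrite leqW //= eq_sym penult_neq_max.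
rewrite 2!(bigD1 (penult r) jp) /= 2!(bigD1 ord_max jm) /= shift_max.
rewrite {1}/shift eqxx !addrA; congr (_ + _); first by ring.
by apply: eq_bigr => i /andP[/andP[_ /negPf ip] /negPf im]; rewrite /shift ip im.
Qed.

Definition rS_factor n x a b (j : 'I_r.+1) : R[i] :=
  poch ((tail a j.+1)%:C + x j / 2) (tail n j.+1) *
  hyp3F2 (- (n j)%:R)
         ((n j)%:R + (2 * tail n j.+1)%N%:R + (tail a j)%:C + (tail b j)%:C - 1)
         ((tail n j.+1)%:R + (tail a j.+1)%:C + x j / 2)
         (lower1 n a b j) (lower2 n a j) 1.

Lemma rS_recr n x a b :
  rS n x a b =
  (\prod_(j < r) rS_factor n x a b (widen_ord (leqnSn r) j))
  * rS_factor n x a b ord_max.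
Proof. exact: big_ord_recr. Qed.

Lemma rS_factor_shift n x a b c d (j : 'I_r) :
  let i := widen_ord (leqnSn r) j in
  rS_factor n x (shift a c) (shift b d) i = rS_factor n x a b i.
Proof. by rewrite /rS_factor /lower1 /lower2 /= !tail_shift // ltnW. Qed.

Lemma lower1_last n a b :
  lower1 n a b ord_max = (a ord_max)%:C + (b ord_max)%:C.
Proof. by rewrite /lower1 tail_oversize !tail_last muln0 add0r. Qed.

Lemma lower2_last n a : lower2 n a ord_max = (tail a r)%:C.
Proof. by rewrite /lower2 tail_oversize add0r. Qed.

Lemma rS_factor_last n x a b :
  rS_factor n x a b ord_max =
  hyp3F2 (- (n ord_max)%:R)
         ((n ord_max)%:R + (tail a r)%:C + (tail b r)%:C - 1)
         ((a ord_max)%:C + x ord_max / 2)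
         ((a ord_max)%:C + (b ord_max)%:C) (tail a r)%:C 1.
Proof.
rewrite /rS_factor lower1_last lower2_last tail_oversize !tail_last muln0.
by rewrite poch0 mul1r addr0 add0r.
Qed.

(** The opposite shifts of [a] and [b] preserve the sum of their last entries, hence the lower
    parameter [lower1] of the last factor. *)
Lemma rS_shift n x a b c :
  rS n x (shift a c) (shift b (- c)) =
  (\prod_(j < r) rS_factor n x a b (widen_ord (leqnSn r) j)) *
  hyp3F2 (- (n ord_max)%:R)
         ((n ord_max)%:R + (tail a r)%:C + (tail b r)%:C - 1)
         ((a ord_max)%:C + x ord_max / 2 - c%:C)
         ((a ord_max)%:C + (b ord_max)%:C) (tail a r)%:C 1.
Proof.
rewrite rS_recr rS_factor_last !(tail_shift _ _ r (leqnn r)) !shift_max.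
rewrite (eq_bigr _ (fun j _ => rS_factor_shift n x a b c (- c) j)).
have -> : (a ord_max - c)%:C + (b ord_max - - c)%:C
    = (a ord_max)%:C + (b ord_max)%:C.
  by rewrite -!rmorphD /= opprK addrACA addNr addr0.
by rewrite (rmorphB _ (a _)) /= [_ - _ + _]addrAC.
Qed.

End Shift.

(* There are [r.+1] variables. *)
Theorem theorem5p16 (R : realType) (r : nat) (n : 'I_r.+1 -> nat)
    (a b : 'I_r.+2 -> R) (x : 'I_r.+1 -> R[i])
    (adm0 : lower_admissible n a b)
    (adm1 : lower_admissible n (shift a 1) (shift b (-1)))
    (adm2 : lower_admissible n (shift a 2) (shift b (-2)))
    (den1_neq0 : den1 x a != 0)
    (den2_neq0 : den2 x a != 0) :
  E0 x a b * rS n x a b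
  + E1 n x a b * rS n x (shift a 1) (shift b (-1))
  + E2 x a b * rS n x (shift a 2) (shift b (-2)) = 0.
Proof.
have [] := adm0 ord_max; rewrite lower1_last lower2_last => pN qN.
rewrite !rS_shift rS_recr rS_factor_last rmorph1 (rmorph_nat _ 2).
(* Here [p] is the sum of the last entries of [a] and [b], [q] and [s] are their tails from [r], and
   [u = c - 1], so that [u + 1], [u], [u - 1] belong to the shifts 0, 1, 2. *)
have := hahn_difference_eq _ (n ord_max) _ _ (tail b r)%:C
  ((a ord_max)%:C + x ord_max / 2 - 1) pN qN.
move: den1_neq0 den2_neq0.
rewrite /E0 /E1 /E2 /den2 /den1 !pochSr poch0 mul1r addr0 subrK.
rewrite /hahn_down /hahn_up -[_ - 1 - 1]addrA -opprD -[1 + 1]/(2%:R).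
set F2 := hyp3F2 _ _ (_ - 2%:R) _ _ _; set F1 := hyp3F2 _ _ (_ - 1) _ _ _.
set F0 := hyp3F2 _ _ _ _ _ _; set P := \prod_(_ < _) _.
rewrite !tail_penult !rmorphD /=.
set y := x ord_max / 2; have -> : x ord_max = 2 * y by rewrite /y; field.
move=> c0; rewrite mulf_eq0 negb_or => /andP[c1 _] /eqP.
rewrite -subr_eq0 => /eqP hahn.
(* The relation is the Hahn equation times [- P / ((c - 1) c)]: [E0] and [E2] are [- hahn_up] and
   [- hahn_down] over [(c - 1) c]. *)
set c := _ + y in c0 c1 *; rewrite -[RHS](mulr0 (- (P / ((c - 1) * c)))) -hahn.
rewrite {}/c in c0 c1 *; move: F0 F1 F2 P y c0 c1 {hahn} => F0 F1 F2 P y c0 c1.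
by field; rewrite c0 c1.
Qed.
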